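(* The dendriform-Nijenhuis algebra (i.e. the ABQR operad with the nine generating operations and 28 relations of a dendriform-Nijenhuis algebra) is isomorphic to the ABQR operad of type $$(\Omega_T,\Lambda_T)\,\square\,(\Omega_N,\Lambda_N),$$ where $(\Omega_T,\Lambda_T)$ is the type of the dendriform trialgebra and $(\Omega_N,\Lambda_N)$ is the type of the NS-algebra.
   Context: $\mathbf{k}$ is a field of characteristic zero. A binary, quadratic, regular operad is identified with its type: a pair $(\Omega,\Lambda)$ with $\Omega$ a finite-dimensional $\mathbf{k}$-vector space of binary operations and $\Lambda\subseteq\Omega^{\otimes 2}\oplus\Omega^{\otimes 2}$ a linear subspace; the element $\big(\sum_i a_i\otimes b_i,\ \sum_j c_j\otimes d_j\big)$ stands for the relation $\sum_i(x\,a_i\,y)\,b_i\,z=\sum_j x\,c_j\,(y\,d_j\,z)$. A structure given by finitely many operation symbols and such relations has type $(\Omega,\Lambda)$ with $\Omega$ having the symbols as basis and $\Lambda$ spanned by the relations. The operad is ABQR with associative operation $\star\in\Omega$ if $(\star\otimes\star,\star\otimes\star)\in\Lambda$. An isomorphism $(\Omega,\Lambda)\to(\Omega',\Lambda')$ of ABQR operads with associative operations $\star,\star'$ is a linear bijection $f:\Omega\to\Omega'$ with $f(\star)=\star'$ and $(f^{\otimes2}\oplus f^{\otimes2})(\Lambda)=\Lambda'$. Square product: write $\left[{\odot_1\atop\odot_2}\right]:=\odot_1\otimes\odot_2\in\Omega_1\otimes\Omega_2$. For $f_i=(a_i\otimes b_i,\ c_i\otimes d_i)$, $i=1,2$, put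 $\left[{f_1\atop f_2}\right]=\left(\left[{a_1\atop a_2}\right]\otimes\left[{b_1\atop b_2}\right],\ \left[{c_1\atop c_2}\right]\otimes\left[{d_1\atop d_2}\right]\right)$, extended bilinearly to $f_i\in\Omega_i^{\otimes2}\oplus\Omega_i^{\otimes2}$ (that is, $((u_1,v_1),(u_2,v_2))\mapsto(\sigma(u_1\otimes u_2),\sigma(v_1\otimes v_2))$, $\sigma$ exchanging the second and third tensor factors). $\Lambda_1\,\square\,\Lambda_2$ is the span of all $\left[{f_1\atop f_2}\right]$ with $f_1\in\Lambda_1,f_2\in\Lambda_2$, and $(\Omega_1,\Lambda_1)\,\square\,(\Omega_2,\Lambda_2)=(\Omega_1\otimes\Omega_2,\Lambda_1\,\square\,\Lambda_2)$, with associative operation $\left[{\star_1\atop\star_2}\right]$. Dendriform trialgebra: $\Omega_T$ has basis $\{\prec,\succ,\circ\}$, $\star=\prec+\succ+\circ$ is the associative operation, and $\Lambda_T$ is spanned by $(\prec\otimes\prec,\prec\otimes\star)$, $(\succ\otimes\prec,\succ\otimes\prec)$, $(\star\otimes\succ,\succ\otimes\succ)$, $(\succ\otimes\circ,\succ\otimes\circ)$, $(\prec\otimes\circ,\circ\otimes\succ)$, $(\circ\otimes\prec,\circ\otimes\prec)$, $(\circ\otimes\circ,\circ\otimes\circ)$. NS-algebra: $\Omega_N$ has basis $\{\prec,\succ,\bullet\}$, $\star=\prec+\succ+\bullet$ is the associative operation, and $\Lambda_N$ is spanned by $(\prec\otimes\prec,\prec\otimes\star)$, $(\succ\otimes\prec,\succ\otimes\prec)$,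 $(\star\otimes\succ,\succ\otimes\succ)$, $(\star\otimes\bullet+\bullet\otimes\prec,\ \succ\otimes\bullet+\bullet\otimes\star)$. Dendriform-Nijenhuis algebra: nine generating operations $\nearrow,\searrow,\swarrow,\nwarrow,\uparrow,\downarrow,\tilde\prec,\tilde\succ,\tilde\bullet$. Auxiliary operations: $\wedge=\nwarrow+\uparrow+\nearrow$, $\tilde\star=\tilde\prec+\tilde\bullet+\tilde\succ$, $\vee=\swarrow+\downarrow+\searrow$, $\triangleleft=\nwarrow+\tilde\prec+\swarrow$, $\bar\bullet=\uparrow+\tilde\bullet+\downarrow$, $\triangleright=\nearrow+\tilde\succ+\searrow$; the associative operation is $\bar\star$, the sum of all nine generating operations. The 28 relations are: $(x\nwarrow y)\nwarrow z=x\nwarrow(y\,\bar\star\,z)$, $(x\nearrow y)\nwarrow z=x\nearrow(y\triangleleft z)$, $(x\wedge y)\nearrow z=x\nearrow(y\triangleright z)$, $(x\wedge y)\uparrow z+(x\uparrow y)\nwarrow z=x\nearrow(y\,\bar\bullet\,z)+x\uparrow(y\,\bar\star\,z)$; $(x\swarrow y)\nwarrow z=x\swarrow(y\wedge z)$, $(x\searrow y)\nwarrow z=x\searrow(y\nwarrow z)$, $(x\vee y)\nearrow z=x\searrow(y\nearrow z)$, $(x\vee y)\uparrow z+(x\downarrow y)\nwarrow z=x\searrow(y\uparrow z)+x\downarrow(y\wedge z)$; $(x\triangleleft y)\swarrow z=x\swarrow(y\vee z)$, $(x\triangleright y)\swarrow z=x\searrow(y\swarrow z)$, $(x\,\bar\star\,y)\searrow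 z=x\searrow(y\searrow z)$, $(x\,\bar\star\,y)\downarrow z+(x\,\bar\bullet\,y)\swarrow z=x\searrow(y\downarrow z)+x\downarrow(y\vee z)$; $(x\swarrow y)\,\tilde\prec\,z=x\swarrow(y\,\tilde\star\,z)$, $(x\searrow y)\,\tilde\prec\,z=x\searrow(y\,\tilde\prec\,z)$, $(x\vee y)\,\tilde\succ\,z=x\searrow(y\,\tilde\succ\,z)$, $(x\vee y)\,\tilde\bullet\,z+(x\downarrow y)\,\tilde\prec\,z=x\searrow(y\,\tilde\bullet\,z)+x\downarrow(y\,\tilde\star\,z)$; $(x\nwarrow y)\,\tilde\prec\,z=x\,\tilde\prec\,(y\vee z)$, $(x\nearrow y)\,\tilde\prec\,z=x\,\tilde\succ\,(y\swarrow z)$, $(x\wedge y)\,\tilde\succ\,z=x\,\tilde\succ\,(y\searrow z)$, $(x\wedge y)\,\tilde\bullet\,z+(x\uparrow y)\,\tilde\prec\,z=x\,\tilde\succ\,(y\downarrow z)+x\,\tilde\bullet\,(y\vee z)$; $(x\,\tilde\prec\,y)\nwarrow z=x\,\tilde\prec\,(y\wedge z)$, $(x\,\tilde\succ\,y)\nwarrow z=x\,\tilde\succ\,(y\nwarrow z)$, $(x\,\tilde\star\,y)\nearrow z=x\,\tilde\succ\,(y\nearrow z)$, $(x\,\tilde\star\,y)\uparrow z+(x\,\tilde\bullet\,y)\nwarrow z=x\,\tilde\succ\,(y\uparrow z)+x\,\tilde\bullet\,(y\wedge z)$; $(x\,\tilde\prec\,y)\,\tilde\prec\,z=x\,\tilde\prec\,(y\,\tilde\star\,z)$,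 $(x\,\tilde\succ\,y)\,\tilde\prec\,z=x\,\tilde\succ\,(y\,\tilde\prec\,z)$, $(x\,\tilde\star\,y)\,\tilde\succ\,z=x\,\tilde\succ\,(y\,\tilde\succ\,z)$, $(x\,\tilde\star\,y)\,\tilde\bullet\,z+(x\,\tilde\bullet\,y)\,\tilde\prec\,z=x\,\tilde\succ\,(y\,\tilde\bullet\,z)+x\,\tilde\bullet\,(y\,\tilde\star\,z)$. *)

(* Defs.v *)
From HB Require Import structures.
From mathcomp Require Import all_boot all_order all_algebra.
From mathcomp Require Import ring.

Set Implicit Arguments.
Unset Strict Implicit.
Unset Printing Implicit Defensive.

Import GRing.Theory.
Local Open Scope ring_scope.

(* The tensor product of two finite-dimensional vector spaces is realised by
   coordinate matrices: entry (i, j) of a tensor is its coordinate on the pure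
   tensor of the i-th and j-th vectors of the bases [vbasis fullv]. By
   [pure_bilinear], [tens_liftE] and [tens_lift_uniq] it has the universal
   property, so nothing below depends on the choice of these bases. *)
Definition tens (k : fieldType) (U V : vectType k) : vectType k :=
  'M[k]_(\dim {:U}, \dim {:V}).

Definition pure (k : fieldType) (U V : vectType k) (u : U) (v : V) : tens U V :=
  \matrix_(i, j) (coord (vbasis {:U}) i u * coord (vbasis {:V}) j v).

Notation "u *t v" := (pure u v) (at level 40, left associativity) : ring_scope.

Definition tens_lift (k : fieldType) (U V W : vectType k) (b : U -> V -> W) :
    'Hom(tens U V, W) :=
  linfun (fun t : tens U V =>
    \sum_i \sum_j t i j *: b (vbasis {:U})`_i (vbasis {:V})`_j).

Lemma tens_lift_coord (k : fieldType) (U V W : vectType k) (b : U -> V -> W)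
    (t : tens U V) :
  tens_lift b t = \sum_i \sum_j t i j *: b (vbasis {:U})`_i (vbasis {:V})`_j.
Proof.
pose g (s : tens U V) : W :=
  \sum_i \sum_j s i j *: b (vbasis {:U})`_i (vbasis {:V})`_j.
have g_lin : linear g.
  move=> a x y; rewrite /g scaler_sumr -big_split /=; apply: eq_bigr => i _.
  rewrite scaler_sumr -big_split /=; apply: eq_bigr => j _.
  by rewrite !mxE scalerDl scalerA.
pose G : {linear tens U V -> W} :=
  HB.pack g (GRing.isLinear.Build k (tens U V) W *:%R g g_lin).
exact: (lfunE G t).
Qed.

Lemma pure_bilinear (k : fieldType) (U V : vectType k) :
  bilinear_for *:%R *:%R (@pure k U V).
Proof.
split=> [v a u1 u2 | u a v1 v2]; apply/matrixP => i j; rewrite !mxE linearP /=.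
  by rewrite mulrDl mulrA.
by rewrite mulrDr mulrCA.
Qed.

Lemma tens_liftE (k : fieldType) (U V W : vectType k) (b : U -> V -> W) :
  bilinear_for *:%R *:%R b -> forall u v, tens_lift b (u *t v) = b u v.
Proof.
move=> [bl br] u v; rewrite tens_lift_coord.
pose bL v : {linear U -> W} :=
  HB.pack (b^~ v) (GRing.isLinear.Build k U W *:%R (b^~ v) (bl v)).
pose bR u : {linear V -> W} :=
  HB.pack (b u) (GRing.isLinear.Build k V W *:%R (b u) (br u)).
have bLE u' v' : b u' v' = bL v' u' by [].
have bRE u' v' : b u' v' = bR u' v' by [].
rewrite [RHS]bLE {2}(coord_vbasis (memvf u)) linear_sum; apply: eq_bigr => i _.
rewrite linearZ -bLE bRE {2}(coord_vbasis (memvf v)) linear_sum.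
rewrite [RHS]scaler_sumr.
by apply: eq_bigr => j _; rewrite linearZ /= scalerA mxE.
Qed.

Lemma tens_lift_uniq (k : fieldType) (U V W : vectType k)
    (f g : 'Hom(tens U V, W)) :
  (forall u v, f (u *t v) = g (u *t v)) -> f = g.
Proof.
move=> fg; apply/lfunP => t.
have delta i j : delta_mx i j = (vbasis {:U})`_i *t (vbasis {:V})`_j.
  apply/matrixP => i' j'; rewrite !mxE !coord_free ?(basis_free (vbasisP _)) //.
  by rewrite -natrM mulnb !(eq_sym _ i) !(eq_sym _ j).
rewrite (matrix_sum_delta t) !linear_sum; apply: eq_bigr => i _.
rewrite !linear_sum; apply: eq_bigr => j _.
by rewrite !linearZ /= delta fg.
Qed.

Definition tens_map (k : fieldType) (U U' V V' : vectType k)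
    (f : 'Hom(U, U')) (g : 'Hom(V, V')) : 'Hom(tens U V, tens U' V') :=
  tens_lift (fun u v => f u *t g v).

Lemma tens_map_pure (k : fieldType) (U U' V V' : vectType k)
    (f : 'Hom(U, U')) (g : 'Hom(V, V')) (u : U) (v : V) :
  tens_map f g (u *t v) = f u *t g v.
Proof.
apply: (@tens_liftE k U V _ (fun u v => f u *t g v)).
have [pl pr] := @pure_bilinear k U' V'.
split=> [v' a u1 u2 | u' a v1 v2]; rewrite linearP; [exact: pl | exact: pr].
Qed.

(* sigma (t (x) s), where sigma exchanges the second and third factors. *)
Definition tens_swap (k : fieldType) (U V : vectType k)
    (t : tens U U) (s : tens V V) : tens (tens U V) (tens U V) :=
  tens_lift (fun a1 b1 =>
    tens_lift (fun a2 b2 => (a1 *t a2) *t (b1 *t b2)) s) t.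

Lemma tens_swap_bilinear (k : fieldType) (U V : vectType k) :
  bilinear_for *:%R *:%R (@tens_swap k U V).
Proof.
split=> [s a t1 t2 | t a s1 s2]; first by rewrite /tens_swap linearP.
rewrite /tens_swap !tens_lift_coord /= scaler_sumr -big_split; apply: eq_bigr => i _.
rewrite /= scaler_sumr -big_split; apply: eq_bigr => j _ /=.
by rewrite linearP scalerDr !scalerA mulrC.
Qed.

Lemma tens_swap_pure (k : fieldType) (U V : vectType k)
    (a1 b1 : U) (a2 b2 : V) :
  tens_swap (a1 *t b1) (a2 *t b2) = (a1 *t a2) *t (b1 *t b2).
Proof.
have [pl pr] := @pure_bilinear k U V.
have [ql qr] := @pure_bilinear k (tens U V) (tens U V).
have inner (a b : U) :
    tens_lift (fun a2 b2 => (a *t a2) *t (b *t b2)) (a2 *t b2)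
    = (a *t a2) *t (b *t b2).
  apply: (@tens_liftE k V V _ (fun a2 b2 => (a *t a2) *t (b *t b2))).
  by split=> [v c u1 u2 | u c v1 v2]; rewrite /= pr; [exact: ql | exact: qr].
pose g (a b : U) := tens_lift (fun u v => (a *t u) *t (b *t v)) (a2 *t b2).
rewrite -[RHS]inner -[RHS]/(g a1 b1); apply: (@tens_liftE k U U _ g).
rewrite /g; split=> [v c u1 u2 | u c v1 v2]; rewrite /= !inner pl.
  exact: ql.
exact: qr.
Qed.

(* (sum a_i (x) b_i, sum c_j (x) d_j) stands for the relation
   sum (x a_i y) b_i z = sum x c_j (y d_j z). *)
Definition relations (k : fieldType) (O : vectType k) : vectType k :=
  (tens O O * tens O O)%type.

Definition rel_map (k : fieldType) (O O' : vectType k) (f : 'Hom(O, O')) :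
    'Hom(relations O, relations O') :=
  linfun (fun r : relations O => (tens_map f f r.1, tens_map f f r.2)).

Lemma rel_mapE (k : fieldType) (O O' : vectType k) (f : 'Hom(O, O'))
    (r : relations O) :
  rel_map f r = (tens_map f f r.1, tens_map f f r.2).
Proof.
pose g (r : relations O) : relations O' :=
  (tens_map f f r.1, tens_map f f r.2).
have g_lin : linear g by move=> a x y; rewrite /g !linearP.
pose G : {linear relations O -> relations O'} :=
  HB.pack g (GRing.isLinear.Build k (relations O) (relations O') *:%R g g_lin).
exact: (lfunE G r).
Qed.

Definition rel_square (k : fieldType) (O1 O2 : vectType k)
    (r1 : relations O1) (r2 : relations O2) : relations (tens O1 O2) :=
  (tens_swap r1.1 r2.1, tens_swap r1.2 r2.2).

Lemma rel_square_bilinear (k : fieldType) (O1 O2 : vectType k) :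
  bilinear_for *:%R *:%R (@rel_square k O1 O2).
Proof.
have [sl sr] := @tens_swap_bilinear k O1 O2.
split=> [s a t1 t2 | t a s1 s2]; rewrite /rel_square.
  by rewrite (sl s.1) (sl s.2).
by rewrite (sr t.1) (sr t.2).
Qed.

(* As for [prodv], bases suffice to span: see [square_relsP]. *)
Definition square_rels (k : fieldType) (O1 O2 : vectType k)
    (L1 : {vspace relations O1}) (L2 : {vspace relations O2}) :
    {vspace relations (tens O1 O2)} :=
  <<[seq rel_square r1 r2 | r1 <- vbasis L1, r2 <- vbasis L2]>>%VS.

Lemma mem_square_rels (k : fieldType) (O1 O2 : vectType k)
    (L1 : {vspace relations O1}) (L2 : {vspace relations O2})
    (r1 : relations O1) (r2 : relations O2) :
  r1 \in L1 -> r2 \in L2 -> rel_square r1 r2 \in square_rels L1 L2.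
Proof.
have [sl sr] := @rel_square_bilinear k O1 O2.
pose sL r : {linear relations O1 -> relations (tens O1 O2)} :=
  HB.pack (@rel_square k O1 O2 ^~ r)
    (GRing.isLinear.Build k _ _ *:%R (@rel_square k O1 O2 ^~ r) (sl r)).
pose sR r : {linear relations O2 -> relations (tens O1 O2)} :=
  HB.pack (@rel_square k O1 O2 r)
    (GRing.isLinear.Build k _ _ *:%R (@rel_square k O1 O2 r) (sr r)).
have sLE x y : rel_square x y = sL y x by [].
have sRE x y : rel_square x y = sR x y by [].
move=> L1r1 L2r2; rewrite (coord_vbasis L1r1) sLE linear_sum.
apply: memv_suml => i _; rewrite linearZ memvZ // -sLE.
rewrite (coord_vbasis L2r2) sRE linear_sum.
apply: memv_suml => j _; rewrite linearZ memvZ // -sRE.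
by apply: memv_span; apply: allpairs_f; apply: mem_nth; rewrite size_tuple.
Qed.

Lemma square_relsP (k : fieldType) (O1 O2 : vectType k)
    (L1 : {vspace relations O1}) (L2 : {vspace relations O2})
    (W : {vspace relations (tens O1 O2)}) :
  reflect
    (forall r1 r2, r1 \in L1 -> r2 \in L2 -> rel_square r1 r2 \in W)
    (square_rels L1 L2 <= W)%VS.
Proof.
apply: (iffP idP) => [sLW r1 r2 Lr1 Lr2 | LW].
  by apply: (subvP sLW); apply: mem_square_rels.
apply/span_subvP => _ /allpairsP[[r1 r2] [/= Lr1 Lr2 ->]].
by apply: LW; apply: vbasis_mem.
Qed.

Record abqr (k : fieldType) := ABQR {
  ops : vectType k;
  rels : {vspace relations ops};
  assoc_op : ops;
  assoc_op_rel : (assoc_op *t assoc_op, assoc_op *t assoc_op) \in rels }.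

Definition abqr_isomorphic (k : fieldType) (P Q : abqr k) : Prop :=
  exists f : 'Hom(ops P, ops Q),
    [/\ bijective f,
        f (assoc_op P) = assoc_op Q
      & (rel_map f @: rels P)%VS = rels Q].

Lemma square_assoc (k : fieldType) (P Q : abqr k) :
  let s := assoc_op P *t assoc_op Q in
  (s *t s, s *t s) \in square_rels (rels P) (rels Q).
Proof.
have := mem_square_rels (assoc_op_rel P) (assoc_op_rel Q).
by rewrite /rel_square /= !tens_swap_pure.
Qed.

Definition square (k : fieldType) (P Q : abqr k) : abqr k :=
  ABQR (square_assoc P Q).

Lemma tens_addE (k : fieldType) (U V : vectType k) (s t : tens U V) i j :
  (s + t : 'M_(_, _)) i j = (s : 'M_(_, _)) i j + (t : 'M_(_, _)) i j.
Proof. by rewrite mxE. Qed.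

Lemma pureE (k : fieldType) (U V : vectType k) (u : U) (v : V) i j :
  (u *t v : 'M_(_, _)) i j = coord (vbasis {:U}) i u * coord (vbasis {:V}) j v.
Proof. by rewrite mxE. Qed.

Lemma sum_mem_span (k : fieldType) (O : vectType k) (s : seq (relations O))
    (t1 t2 : tens O O) :
  (forall i j, \sum_(r <- s) (r.1 : 'M_(_, _)) i j = (t1 : 'M_(_, _)) i j) ->
  (forall i j, \sum_(r <- s) (r.2 : 'M_(_, _)) i j = (t2 : 'M_(_, _)) i j) ->
  (t1, t2) \in <<s>>%VS.
Proof.
move=> st1 st2; have <- : \sum_(r <- s) r = (t1, t2).
  have fstE (s' : seq (relations O)) : (\sum_(r <- s') r).1 = \sum_(r <- s') r.1.
    by elim: s' => [|r s' IH]; rewrite ?big_nil // !big_cons -IH.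
  have sndE (s' : seq (relations O)) : (\sum_(r <- s') r).2 = \sum_(r <- s') r.2.
    by elim: s' => [|r s' IH]; rewrite ?big_nil // !big_cons -IH.
  rewrite [LHS]surjective_pairing fstE sndE; congr pair; apply/matrixP => i j.
    by rewrite -st1 -summxE.
  by rewrite -st2 -summxE.
by rewrite big_seq rpred_sum // => r; apply: memv_span.
Qed.

(* Each associative operation below satisfies associativity because that
   relation is the sum of the listed ones. *)

Definition tri_star (k : fieldType) (O : vectType k) (prec succ circ : O) : O :=
  prec + succ + circ.

Definition tri_relations (k : fieldType) (O : vectType k)
    (prec succ circ : O) : seq (relations O) :=
  let star := tri_star prec succ circ in
  [:: (prec *t prec, prec *t star);
      (succ *t prec, succ *t prec);
      (star *t succ, succ *t succ);
      (succ *t circ, succ *t circ);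
      (prec *t circ, circ *t succ);
      (circ *t prec, circ *t prec);
      (circ *t circ, circ *t circ)].

Lemma tri_assoc (k : fieldType) (O : vectType k) (prec succ circ : O) :
  let star := tri_star prec succ circ in
  (star *t star, star *t star) \in <<tri_relations prec succ circ>>%VS.
Proof.
by apply: sum_mem_span => i j; rewrite !big_cons big_nil /= ?tens_addE !pureE
  /tri_star !linearD /=; ring.
Qed.

Definition NS_star (k : fieldType) (O : vectType k) (prec succ bullet : O) : O :=
  prec + succ + bullet.

Definition NS_relations (k : fieldType) (O : vectType k)
    (prec succ bullet : O) : seq (relations O) :=
  let star := NS_star prec succ bullet in
  [:: (prec *t prec, prec *t star);
      (succ *t prec, succ *t prec);
      (star *t succ, succ *t succ);
      (star *t bullet + bullet *t prec, succ *t bullet + bullet *t star)].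

Lemma NS_assoc (k : fieldType) (O : vectType k) (prec succ bullet : O) :
  let star := NS_star prec succ bullet in
  (star *t star, star *t star) \in <<NS_relations prec succ bullet>>%VS.
Proof.
by apply: sum_mem_span => i j; rewrite !big_cons big_nil /= ?tens_addE !pureE
  /NS_star !linearD /=; ring.
Qed.

Definition DN_star (k : fieldType) (O : vectType k)
    (ne se sw nw up down tprec tsucc tbullet : O) : O :=
  ne + se + sw + nw + up + down + tprec + tsucc + tbullet.

(* [ne], [se], [sw], [nw] are the diagonal arrows, [t*] the operations with a
   tilde, [bstar] and [bbullet] those with a bar, [trileft] and [triright] the
   triangles. *)
Definition DN_relations (k : fieldType) (O : vectType k)
    (ne se sw nw up down tprec tsucc tbullet : O) : seq (relations O) :=
  let wedge := nw + up + ne in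
  let tstar := tprec + tbullet + tsucc in
  let vee := sw + down + se in
  let trileft := nw + tprec + sw in
  let bbullet := up + tbullet + down in
  let triright := ne + tsucc + se in
  let bstar := DN_star ne se sw nw up down tprec tsucc tbullet in
  [:: (nw *t nw, nw *t bstar);
      (ne *t nw, ne *t trileft);
      (wedge *t ne, ne *t triright);
      (wedge *t up + up *t nw, ne *t bbullet + up *t bstar);

      (sw *t nw, sw *t wedge);
      (se *t nw, se *t nw);
      (vee *t ne, se *t ne);
      (vee *t up + down *t nw, se *t up + down *t wedge);

      (trileft *t sw, sw *t vee);
      (triright *t sw, se *t sw);
      (bstar *t se, se *t se);
      (bstar *t down + bbullet *t sw, se *t down + down *t vee);

      (sw *t tprec, sw *t tstar);
      (se *t tprec, se *t tprec);
      (vee *t tsucc, se *t tsucc);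
      (vee *t tbullet + down *t tprec, se *t tbullet + down *t tstar);

      (nw *t tprec, tprec *t vee);
      (ne *t tprec, tsucc *t sw);
      (wedge *t tsucc, tsucc *t se);
      (wedge *t tbullet + up *t tprec, tsucc *t down + tbullet *t vee);

      (tprec *t nw, tprec *t wedge);
      (tsucc *t nw, tsucc *t nw);
      (tstar *t ne, tsucc *t ne);
      (tstar *t up + tbullet *t nw, tsucc *t up + tbullet *t wedge);

      (tprec *t tprec, tprec *t tstar);
      (tsucc *t tprec, tsucc *t tprec);
      (tstar *t tsucc, tsucc *t tsucc);
      (tstar *t tbullet + tbullet *t tprec,
       tsucc *t tbullet + tbullet *t tstar)].

Lemma DN_assoc (k : fieldType) (O : vectType k)
    (ne se sw nw up down tprec tsucc tbullet : O) :
  let bstar := DN_star ne se sw nw up down tprec tsucc tbullet in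
  (bstar *t bstar, bstar *t bstar)
    \in <<DN_relations ne se sw nw up down tprec tsucc tbullet>>%VS.
Proof.
by apply: sum_mem_span => i j; rewrite !big_cons big_nil /= ?tens_addE !pureE
  /DN_star !linearD /=; ring.
Qed.

(* The i-th of [n.+1] operation symbols, in the space with these symbols as
   basis. *)
Definition symbol (k : fieldType) (n i : nat) : 'rV[k]_n.+1 :=
  delta_mx 0 (inord i).

Definition dendriform_trialgebra (k : fieldType) : abqr k :=
  let e := symbol k 2 in ABQR (tri_assoc (e 0%N) (e 1%N) (e 2%N)).

Definition NS_algebra (k : fieldType) : abqr k :=
  let e := symbol k 2 in ABQR (NS_assoc (e 0%N) (e 1%N) (e 2%N)).

Definition dendriform_Nijenhuis (k : fieldType) : abqr k :=
  let e := symbol k 8 in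
  ABQR (DN_assoc (e 0%N) (e 1%N) (e 2%N) (e 3%N) (e 4%N)
    (e 5%N) (e 6%N) (e 7%N) (e 8%N)).

(* Main.v *)
Require Import Defs.
From HB Require Import structures.
From mathcomp Require Import all_boot all_order all_algebra.
From mathcomp Require Import ring.

Import GRing.Theory.
Local Open Scope ring_scope.

(* The isomorphism sends ne, se, sw, nw, up, down to [prec/succ], [succ/succ],
   [succ/prec], [prec/prec], [prec/bullet], [succ/bullet], and the operations
   with a tilde to [circ/prec], [circ/succ], [circ/bullet], where in [a/b] the
   entry a is a dendriform trialgebra operation and b an NS-operation. The
   auxiliary sums of operations are then the pure tensors having the total
   operation in at least one factor. Since the square product of spans is
   spanned by the products of generators, the 7 * 4 products of defining
   relations can be compared with the 28 relations one by one. *)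

Lemma bilinear_span (k : fieldType) (U V W : vectType k) (b : U -> V -> W)
    (X : seq U) (Y : seq V) (u : U) (v : V) :
  bilinear_for *:%R *:%R b -> u \in <<X>>%VS -> v \in <<Y>>%VS ->
  b u v \in <<[seq b x y | x <- X, y <- Y]>>%VS.
Proof.
move=> bP Xu Yv.
pose B : {bilinear U -> V -> W} :=
  HB.pack b (bilinear_isBilinear.Build k U V W *:%R *:%R b bP).
rewrite -[b u v]/(B u v) (coord_span (X := in_tuple X) Xu) linear_sumlz.
apply: memv_suml => i _; rewrite linearZl_LR memvZ //.
rewrite (coord_span (X := in_tuple Y) Yv) linear_sumr.
apply: memv_suml => j _; rewrite linearZr_LR memvZ //.
by apply/memv_span/allpairs_f; apply: mem_nth.
Qed.

Lemma square_rels_span (k : fieldType) (O1 O2 : vectType k)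
    (s1 : seq (relations O1)) (s2 : seq (relations O2)) :
  square_rels <<s1>> <<s2>> =
  <<[seq rel_square r1 r2 | r1 <- s1, r2 <- s2]>>%VS.
Proof.
apply/eqP; rewrite eqEsubv; apply/andP; split.
  apply/square_relsP => r1 r2; apply: bilinear_span.
  exact: rel_square_bilinear.
apply/span_subvP => _ /allpairsP[[r1 r2] [/= s1r s2r ->]].
by apply: mem_square_rels; apply: memv_span.
Qed.

(** By the universal property the identity is the lift of [pure], so every tensor is a combination
    of pure tensors of basis vectors, and [bilinear_span] applies to each. *)
Lemma pure_span (k : fieldType) (U V : vectType k) (X : seq U) (Y : seq V) :
  <<X>>%VS = fullv -> <<Y>>%VS = fullv ->
  <<[seq x *t y | x <- X, y <- Y]>>%VS = fullv.
Proof.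
move=> Xfull Yfull; apply/eqP; rewrite eqEsubv subvf; apply/subvP => t _.
set S := (S in t \in S).
have -> : t = tens_lift (@pure k U V) t.
  have -> : tens_lift (@pure k U V) = \1%VF.
    apply: tens_lift_uniq => u v.
    by rewrite tens_liftE ?id_lfunE //; exact: pure_bilinear.
  by rewrite id_lfunE.
rewrite tens_lift_coord; apply: memv_suml => i _; apply: memv_suml => j _.
rewrite memvZ //; apply: bilinear_span; first exact: pure_bilinear.
  by rewrite Xfull memvf.
by rewrite Yfull memvf.
Qed.

Lemma symbol_span (k : fieldType) (n : nat) :
  <<[seq symbol k n i | i <- iota 0 n.+1]>>%VS = fullv.
Proof.
apply/eqP; rewrite eqEsubv subvf; apply/subvP => v _.
rewrite [v]row_sum_delta; apply: memv_suml => i _; rewrite memvZ //.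
apply: memv_span; apply/mapP; exists (val i).
  by rewrite mem_iota ltn_ord.
by rewrite /symbol inord_val.
Qed.

(** Surjective because [Y] spans; injective by rank-nullity, since equal sizes force equal
    dimensions. *)
Lemma basis_iso (k : fieldType) (V W : vectType k) (X : seq V) (Y : seq W) :
  basis_of fullv X -> basis_of fullv Y -> size X = size Y ->
  exists2 f : 'Hom(V, W), bijective f & map f X = Y.
Proof.
move=> Xb Yb sXY; have [g /(_ (basis_free Xb) (esym sXY)) gX] := linear_of_free X Y.
have fX : map (linfun g) X = Y by rewrite -gX; apply: eq_map => x; rewrite lfunE.
have limg_full : limg (linfun g) = fullv.
  by rewrite -(span_basis Xb) limg_span fX (span_basis Yb).
have ker0 : lker (linfun g) == 0%VS.
  have := limg_ker_dim (linfun g) fullv.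
  have dimV : \dim {:V} = size X by rewrite (size_basis (X := in_tuple X) Xb).
  have dimW : \dim {:W} = size Y by rewrite (size_basis (X := in_tuple Y) Yb).
  rewrite capfv limg_full dimV dimW sXY => /eqP.
  by rewrite -{2}[size Y]add0n eqn_add2r dimv_eq0.
exists (linfun g) => //; exists (linfun g)^-1%VF; first exact: lker0_lfunK.
by move=> w; rewrite limg_lfunVK // limg_full memvf.
Qed.

Lemma DN_relations_map (k : fieldType) (O O' : vectType k) (f : 'Hom(O, O'))
    (ne se sw nw up down tprec tsucc tbullet : O) :
  map (rel_map f) (DN_relations ne se sw nw up down tprec tsucc tbullet) =
  DN_relations (f ne) (f se) (f sw) (f nw) (f up) (f down)
    (f tprec) (f tsucc) (f tbullet).
Proof.
by rewrite /DN_relations /DN_star /= !rel_mapE /= !linearD /= !tens_map_pure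
  !linearD.
Qed.

Lemma DN_star_pure (k : fieldType) (O1 O2 : vectType k)
    (prec succ circ : O1) (prec' succ' bullet : O2) :
  DN_star (prec *t succ') (succ *t succ') (succ *t prec') (prec *t prec')
    (prec *t bullet) (succ *t bullet)
    (circ *t prec') (circ *t succ') (circ *t bullet) =
  tri_star prec succ circ *t NS_star prec' succ' bullet.
Proof.
by apply/matrixP => i j; rewrite /DN_star !tens_addE !pureE !linearD /=; ring.
Qed.

(* Each relation of the trialgebra, paired with the four NS-relations, gives a
   block of four dendriform-Nijenhuis relations, in the listed order. *)
Lemma square_tri_NS (k : fieldType) (O1 O2 : vectType k)
    (prec succ circ : O1) (prec' succ' bullet : O2) :
  [seq rel_square r1 r2 | r1 <- tri_relations prec succ circ,
                          r2 <- NS_relations prec' succ' bullet] =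
  DN_relations (prec *t succ') (succ *t succ') (succ *t prec') (prec *t prec')
    (prec *t bullet) (succ *t bullet)
    (circ *t prec') (circ *t succ') (circ *t bullet).
Proof.
(* The summands here and in [pure_col] follow the order of the auxiliary sums in [DN_relations], so
   that the two lists agree syntactically. *)
have pure_row (x : O1) : x *t NS_star prec' succ' bullet =
    x *t prec' + x *t bullet + x *t succ'.
  by apply/matrixP => i j; rewrite !tens_addE !pureE !linearD /=; ring.
have pure_col (y : O2) : tri_star prec succ circ *t y =
    prec *t y + circ *t y + succ *t y.
  by apply/matrixP => i j; rewrite !tens_addE !pureE !linearD /=; ring.
(* For the last NS-relation, whose two sides are sums. *)
have swapDr t : {morph @tens_swap k O1 O2 t : s1 s2 / s1 + s2}.
  move=> s1 s2; have [_ swap_lin] := @tens_swap_bilinear k O1 O2.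
  by rewrite -{1}[s1]scale1r swap_lin /= scale1r.
(* [DN_star_pure] must come first: [pure_row] would split the total operation as well. *)
by rewrite /= /rel_square /= !swapDr !tens_swap_pure -DN_star_pure !pure_row
  !pure_col.
Qed.

Theorem proposition3p6 (k : fieldType) (char0 : [pchar k] =i pred0) :
  abqr_isomorphic (dendriform_Nijenhuis k)
    (square (dendriform_trialgebra k) (NS_algebra k)).
Proof.
pose e := symbol k 2.
(* In the order of the nine symbols of [DN_relations]. *)
pose pairs := [:: (0, 1); (1, 1); (1, 0); (0, 0); (0, 2); (1, 2); (2, 0); (2, 1);
  (2, 2)]%N.
pose X := [seq symbol k 8 i | i <- iota 0 9].
pose Y := [seq e p.1 *t e p.2 | p <- pairs].
have dim3 : \dim {: 'rV[k]_3} = 3%N by rewrite dimvf dim_matrix.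
have Xb : basis_of fullv X.
  by rewrite basisEdim symbol_span subvv dimvf dim_matrix.
have Yb : basis_of fullv Y.
  (* Nine vectors in dimension 3 * 3 form a basis once they span; they do because [pairs] exhausts
     the 3 by 3 grid of indices. *)
  rewrite basisEdim dimvf dim_matrix !dim3 andbT.
  rewrite -(@pure_span _ _ _ _ _ (symbol_span k 2) (symbol_span k 2)).
  apply/sub_span => t; rewrite allpairs_mapl allpairs_mapr.
  move=> /allpairsP[p [p1 p2 ->]]; apply: (map_f (fun p => e p.1 *t e p.2)).
  have grid : all (mem pairs) [seq (i, j) | i <- iota 0 3, j <- iota 0 3] by [].
  by apply: (allP grid); rewrite [p]surjective_pairing allpairs_f.
have [f fbij [f0 f1 f2 f3 f4 f5 f6 f7 f8]] := @basis_iso _ _ _ _ _ Xb Yb (erefl _).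
exists f; split=> //.
  by rewrite /= -DN_star_pure {1}/DN_star !linearD /= f0 f1 f2 f3 f4 f5 f6 f7 f8.
rewrite /= limg_span DN_relations_map square_rels_span square_tri_NS.
by rewrite f0 f1 f2 f3 f4 f5 f6 f7 f8.
Qed.
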